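(* Let $m\ge 1$ and let $L_1,\dots,L_m$ be finite sequences of elements of a totally ordered set, each sorted in non-decreasing order (duplicates allowed), with lengths $n_t=|L_t|$, and let $K\in\{0,1,\dots,\sum_{t=1}^m n_t\}$. Then the Multi-Way Co-Ranking algorithm (defined in the context), run on input $(L_1,\dots,L_m;K)$, terminates with a valid co-rank vector $(i_1,\dots,i_m)$, i.e. a vector of integers with $0\le i_t\le n_t$ for all $t$ satisfying $$\sum_{t=1}^m i_t=K\qquad\text{and}\qquad \max_{1\le t\le m}\ell_t\le\min_{1\le t\le m} r_t,$$ where $\ell_t=-\infty$ if $i_t=0$ and $\ell_t=L_t[i_t-1]$ otherwise, and $r_t=+\infty$ if $i_t=n_t$ and $r_t=L_t[i_t]$ otherwise.
   Context: Sequences are indexed from $0$: $L_t=(L_t[0],\dots,L_t[n_t-1])$. The symbols $-\infty$ and $+\infty$ are sentinels, respectively smaller and larger than every element. For a current index vector $(i_1,\dots,i_m)$ with $0\le i_t\le n_t$, the boundary values are $\ell_t=-\infty$ if $i_t=0$, else $\ell_t=L_t[i_t-1]$; and $r_t=+\infty$ if $i_t=n_t$, else $r_t=L_t[i_t]$. Multi-Way Co-Ranking algorithm. Initialization. Set integer bounds $L_b[t]=0$ and $U_b[t]=n_t$ for all $t$. Set $i_t=0$ for all $t$ and $\mathrm{need}=K$. For $t=1,\dots,m$ in order: let $\mathrm{take}=\min\{U_b[t]-i_t,\mathrm{need}\}$, replace $i_t$ by $i_t+\mathrm{take}$ and $\mathrm{need}$ by $\mathrm{need}-\mathrm{take}$,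 and leave this loop once $\mathrm{need}=0$. (After this, $\sum_t i_t=K$.) Then repeat the following round: 1. Let $x=\max_t\ell_t$ and let $p$ be the largest index $t$ with $\ell_t=x$ (the donor). Let $y=\min_t r_t$ and let $q$ be the smallest index $t$ with $r_t=y$ (the receiver). 2. If $x<y$, or if $x=y$ and $p\le q$, stop and return $(i_1,\dots,i_m)$. 3. Let $\Delta_p=\left\lceil (i_p-L_b[p])/2\right\rceil$, $\Delta_q=\left\lceil (U_b[q]-i_q)/2\right\rceil$, and $\Delta=\min\{\Delta_p,\Delta_q\}$. If $\Delta=0$, break out of the loop (with the current vector $(i_1,\dots,i_m)$). 4. Set $U_b[p]\leftarrow i_p$ and $L_b[q]\leftarrow i_q$ (using the values of $i_p,i_q$ before the move). 5. Set $i_p\leftarrow i_p-\Delta$ and $i_q\leftarrow i_q+\Delta$, recompute $\ell_p,r_p,\ell_q,r_q$, and go to the next round. *)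

(* Defs.v *)
From HB Require Import structures.
From mathcomp Require Import all_boot all_order.
From mathcomp Require Import interval.

Set Implicit Arguments.
Unset Strict Implicit.
Unset Printing Implicit Defensive.

Local Open Scope nat_scope.
Local Open Scope order_scope.

(* Throughout, there are m.+1 sequences (hence at least one), numbered by
   'I_m.+1. *)
Definition ivec (m : nat) := {ffun 'I_m.+1 -> nat}.

Definition upd (m : nat) (f : ivec m) (t : 'I_m.+1) (k : nat) : ivec m :=
  [ffun u => if u == t then k else f u].

(* The order T with sentinels -oo and +oo adjoined is rendered by itv_bound T,
   in which an element x of T is represented by BLeft x: BLeft preserves and
   reflects the order, and -oo < BLeft x < +oo. *)

(* In bl and br, for k <= size s the default value of nth is never reached. *)
Definition bl (d : Order.disp_t) (T : orderType d) (s : seq T) (k : nat) :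
    itv_bound T :=
  if k == 0%N then -oo else nth -oo [seq BLeft x | x <- s] k.-1.

Definition br (d : Order.disp_t) (T : orderType d) (s : seq T) (k : nat) :
    itv_bound T :=
  if k == size s then +oo else nth +oo [seq BLeft x | x <- s] k.

Section CoRank.

Variables (d : Order.disp_t) (T : orderType d) (m : nat).
Variable L : 'I_m.+1 -> seq T.

Definition max_bl (i : ivec m) : itv_bound T :=
  \big[Order.max/-oo]_(t < m.+1) bl (L t) (i t).

Definition min_br (i : ivec m) : itv_bound T :=
  \big[Order.min/+oo]_(t < m.+1) br (L t) (i t).

Definition valid_corank (K : nat) (i : ivec m) : Prop :=
  [/\ forall t, (i t <= size (L t))%N,
      (\sum_(t < m.+1) i t = K)%N
    & max_bl i <= min_br i].

(* enum 'I_m.+1 is increasing, and both filtered lists are nonempty, so that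
   the default ord0 is never used. *)
Definition donor (i : ivec m) : 'I_m.+1 :=
  last ord0 [seq t <- enum 'I_m.+1 | bl (L t) (i t) == max_bl i].

Definition receiver (i : ivec m) : 'I_m.+1 :=
  head ord0 [seq t <- enum 'I_m.+1 | br (L t) (i t) == min_br i].

Record state := State { lb : ivec m; ub : ivec m; idx : ivec m }.

Fixpoint fill (ub : ivec m) (ts : seq 'I_m.+1) (i : ivec m) (need : nat) :
    ivec m :=
  if ts is t :: ts' then
    let take := minn (ub t - i t)%N need in
    let i' := upd i t (i t + take)%N in
    let need' := (need - take)%N in
    if need' == 0%N then i' else fill ub ts' i' need'
  else i.

Definition init (K : nat) : state :=
  let lb0 : ivec m := [ffun=> 0%N] in
  let ub0 : ivec m := [ffun t => size (L t)] in
  State lb0 ub0 (fill ub0 (enum 'I_m.+1) [ffun=> 0%N] K).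

Variant outcome := Return of ivec m | Continue of state.

(* uphalf k is the ceiling of k / 2. The truncated subtractions are exact,
   since lb t <= idx t <= ub t holds in every state reached from init K. *)
Definition round (s : state) : outcome :=
  let i := idx s in
  let x := max_bl i in
  let p := donor i in
  let y := min_br i in
  let q := receiver i in
  if (x < y) || (x == y) && (p <= q)%N then Return i else
  let delta := minn (uphalf (i p - lb s p)%N) (uphalf (ub s q - i q)%N) in
  if delta == 0%N then Return i else
  let i' := upd i p (i p - delta)%N in
  Continue (State (upd (lb s) q (i q)) (upd (ub s) p (i p))
                  (upd i' q (i' q + delta)%N)).

Fixpoint run (fuel : nat) (s : state) : option (ivec m) :=
  if fuel is fuel'.+1 then
    match round s with
    | Return i => Some i
    | Continue s' => run fuel' s'
    end
  else None.

Definition corank_returns (K : nat) (i : ivec m) : Prop :=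
  exists fuel : nat, run fuel (init K) = Some i.

End CoRank.

(* Main.v *)
Require Import Defs.
From mathcomp Require Import all_boot all_order.
From mathcomp Require Import interval zify.

(** Order the entries lexicographically by (value, number of the sequence): this
makes the co-rank vector unique, and the stopping test of the algorithm holds
exactly at this stable vector [g].  As long as the current vector [i] has not
reached [g], the donor [p] satisfies [g p < i p] and the receiver [q] satisfies
[i q < g q].  Hence the bounds always enclose [g], the step [delta] is never 0,
and the algorithm can only stop at a valid vector.  It stops because every round
decreases the potential [gap] of both the donor and the receiver; the width of
the search interval alone may stay constant when the current index sits at an
endpoint, which is why [gap] has a second summand. *)

Section CoRank.

Local Set Implicit Arguments.
Local Unset Strict Implicit.

Import Order.TTheory.
Local Open Scope order_scope.

(** * Vectors of equal sum; extremal members of sorted lists of ordinals *)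

Lemma sum_nat_eq_ltn (I : finType) (f g : I -> nat) (v : I) :
  (\sum_i f i = \sum_i g i)%N -> (f v != g v) -> exists u, (f u < g u)%N.
Proof.
move=> eq_fg ne_v; apply/existsP; apply: contraNT ne_v => /existsPn fg.
have le_gf u : true -> (g u <= f u ?= iff (g u == f u))%N.
  by move=> _; split=> //; rewrite leqNgt fg.
have [_] := leqif_sum le_gf; rewrite eq_fg eqxx => /esym/forallP/(_ v) /=.
by rewrite eq_sym.
Qed.

Lemma le_last_sorted (n : nat) (s : seq 'I_n) (x0 t : 'I_n) :
  sorted <=%O s -> t \in s -> t <= last x0 s.
Proof.
case/lastP: s => // s y sorted_s; rewrite last_rcons mem_rcons inE.
case/predU1P=> [-> //|ts]; move: sorted_s.
rewrite le_sorted_pairwise pairwise_rcons => /andP[/allP/(_ t ts)] //.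
Qed.

Lemma head_le_sorted (n : nat) (s : seq 'I_n) (x0 t : 'I_n) :
  sorted <=%O s -> t \in s -> head x0 s <= t.
Proof.
case: s => // y s; rewrite le_sorted_pairwise /= => /andP[/allP le_y _].
by rewrite inE => /predU1P[-> //|/le_y].
Qed.

Lemma sorted_enum_ord (n : nat) : sorted <=%O (enum 'I_n).
Proof.
have := iota_sorted 0 n; rewrite -val_enum_ord sorted_map.
by apply: sub_sorted => x y; rewrite leEord.
Qed.

(** * Boundary values of a single sorted sequence *)

Section Bounds.

Context {d : Order.disp_t} {T : orderType d} {s : seq T}.
Hypothesis s_sorted : sorted <=%O s.

Lemma br_le_bl (j k : nat) : (j < k <= size s)%N -> br s j <= bl s k.
Proof.
case/andP=> jk ks; rewrite /br /bl ltn_eqF ?(leq_trans jk) //.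
case: k jk ks => // k jk ks /=.
have x0 : T by case: (s) ks.
rewrite !(nth_map x0) //; last by lia.
rewrite leBSide /=; apply: le_sorted_leq_nth => //; rewrite inE //.
exact: leq_trans jk ks.
Qed.

Lemma bl_succ (k : nat) : (k < size s)%N -> bl s k.+1 = br s k.
Proof.
move=> ks; rewrite /br /bl (ltn_eqF ks) /=.
have x0 : T by case: (s) ks.
by rewrite !(nth_map x0).
Qed.

Lemma br_mono (j k : nat) : (j <= k <= size s)%N -> br s j <= br s k.
Proof.
case/andP; rewrite leq_eqVlt => /predU1P[-> //|jk ks].
case: (eqVneq k (size s)) => [->|ne]; first by rewrite {2}/br eqxx bnd_simp.
have lt_k : (k < size s)%N by rewrite ltn_neqAle ne.
by rewrite -[br s k]bl_succ // br_le_bl // ltnS ltnW.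
Qed.

Lemma bl_mono (j k : nat) : (j <= k <= size s)%N -> bl s j <= bl s k.
Proof.
case: j => [|j] jk; first by rewrite {1}/bl eqxx bnd_simp.
by rewrite bl_succ; [rewrite br_le_bl|]; lia.
Qed.

Lemma br_lt_pinfty (k : nat) : (k < size s)%N -> br s k < +oo.
Proof.
move=> ks; rewrite /br (ltn_eqF ks).
have x0 : T by case: (s) ks.
by rewrite (nth_map x0).
Qed.

End Bounds.

(** * Donor and receiver as lexicographic extrema *)

Context {d : Order.disp_t} {T : orderType d} {m : nat}.
Context {L : 'I_m.+1 -> seq T}.
Hypothesis L_sorted : forall t, sorted <=%O (L t).

Implicit Types (i g : ivec m) (s : state m).

(** Breaking ties by the index turns [donor], the last maximiser of [bl], into the maximum of
    [lkey], and [receiver], the first minimiser of [br], into the minimum of [rkey]. *)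
Let lkey i t : itv_bound T *l 'I_m.+1 := (bl (L t) (i t), t).
Let rkey i t : itv_bound T *l 'I_m.+1 := (br (L t) (i t), t).

Let key_le {a b : itv_bound T} (t : 'I_m.+1) :
  a <= b -> ((a, t) : itv_bound T *l 'I_m.+1) <= (b, t).
Proof. by move=> ab; rewrite lexi_pair ab lexx implybT. Qed.

(** The maximum is attained at some index, so the filtered list is nonempty and [last] never falls
    back on [ord0]. *)
Lemma bl_donor i : bl (L (donor L i)) (i (donor L i)) = max_bl L i.
Proof.
have [||t _ mt] := @eq_bigmax _ _ _ -oo ord0 predT (fun t => bl (L t) (i t)).
- by [].
- by move=> t _; rewrite bnd_simp.
set l := [seq t <- enum 'I_m.+1 | bl (L t) (i t) == max_bl L i].
have tl : t \in l by rewrite mem_filter mem_enum /max_bl mt eqxx.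
suff : donor L i \in l by rewrite mem_filter => /andP[/eqP].
by rewrite /donor -/l; case: (l) tl => //= x l' _; apply: mem_last.
Qed.

Lemma br_receiver i : br (L (receiver L i)) (i (receiver L i)) = min_br L i.
Proof.
have [||t _ mt] := @eq_bigmin _ _ _ +oo ord0 predT (fun t => br (L t) (i t)).
- by [].
- by move=> t _; rewrite bnd_simp.
set l := [seq t <- enum 'I_m.+1 | br (L t) (i t) == min_br L i].
have tl : t \in l by rewrite mem_filter mem_enum /min_br mt eqxx.
suff : receiver L i \in l by rewrite mem_filter => /andP[/eqP].
by rewrite /receiver -/l; case: (l) tl => //= x l' _; apply: mem_head.
Qed.

Lemma lkey_donor i t : lkey i t <= lkey i (donor L i).
Proof.
rewrite lexi_pair bl_donor le_bigmax /=; apply/implyP => le_max.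
apply: le_last_sorted; first exact/le_sorted_filter/sorted_enum_ord.
by rewrite mem_filter mem_enum andbT eq_le le_max le_bigmax.
Qed.

Lemma rkey_receiver i t : rkey i (receiver L i) <= rkey i t.
Proof.
rewrite lexi_pair br_receiver bigmin_le /=; apply/implyP => le_min.
apply: head_le_sorted; first exact/le_sorted_filter/sorted_enum_ord.
by rewrite mem_filter mem_enum andbT eq_le le_min bigmin_le.
Qed.

(** * Stable vectors and the stopping test *)

Definition stable i := forall t u, lkey i t <= rkey i u.

Definition fits i := forall t, (i t <= size (L t))%N.

(** The two keys compared are the extremal ones, so the stopping test decides [stable i]. *)
Lemma stop_lexi i :
  (max_bl L i < min_br L i)
    || (max_bl L i == min_br L i) && (donor L i <= receiver L i)%N
  = (lkey i (donor L i) <= rkey i (receiver L i)).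
Proof.
rewrite lexi_pair bl_donor br_receiver leEord.
by case: (ltgtP (max_bl L i) (min_br L i)).
Qed.

Lemma rkey_le_lkey i g u : fits i -> (g u < i u)%N -> rkey g u <= lkey i u.
Proof. by move=> fi gi; apply/key_le/br_le_bl; rewrite ?gi ?fi. Qed.

(** With [p] the donor, [i p <= g p] would give [lkey i u <= lkey i p <= lkey g p <= rkey g u <=
    lkey i u]. All are then equal, and the second components force [u = p], against [g u < i u]. *)
Lemma donor_excess g i : fits g -> fits i -> stable g ->
  (exists u : 'I_m.+1, g u < i u)%N -> (g (donor L i) < i (donor L i))%N.
Proof.
move=> fg fi st [u gi]; rewrite ltnNge; apply/negP => ig.
set p := donor L i in ig *.
have le_p : lkey i p <= lkey g p by apply/key_le/bl_mono; rewrite ?ig ?fg.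
have eq_up : lkey i u = lkey i p.
  apply/le_anti; rewrite lkey_donor /=.
  exact: le_trans le_p (le_trans (st p u) (rkey_le_lkey fi gi)).
have [_ up] := eq_up; by rewrite up ltnNge ig in gi.
Qed.

Lemma receiver_deficit g i : fits g -> fits i -> stable g ->
  (exists u : 'I_m.+1, i u < g u)%N -> (i (receiver L i) < g (receiver L i))%N.
Proof.
move=> fg fi st [u ig]; rewrite ltnNge; apply/negP => gi.
set q := receiver L i in gi *.
have le_q : rkey g q <= rkey i q by apply/key_le/br_mono; rewrite ?gi ?fi.
have eq_uq : rkey i u = rkey i q.
  apply/le_anti; rewrite rkey_receiver andbT.
  exact: le_trans (rkey_le_lkey fg ig) (le_trans (st u q) le_q).
have [_ uq] := eq_uq; by rewrite uq ltnNge gi in ig.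
Qed.

Lemma sum_upd i t k : (\sum_(u < m.+1) upd i t k u + i t = \sum_(u < m.+1) i u + k)%N.
Proof.
rewrite (bigD1 t) //= [in RHS](bigD1 t) //= ffunE eqxx.
rewrite (eq_bigr i); first by rewrite [LHS]addnC addnA [RHS]addnAC.
by move=> u /negPf ut; rewrite ffunE ut.
Qed.

Lemma sum_move i p q delta : (delta <= i p)%N ->
  let i' := upd i p (i p - delta)%N in
  (\sum_(u < m.+1) upd i' q (i' q + delta)%N u = \sum_(u < m.+1) i u)%N.
Proof.
move=> le_delta i'; have := sum_upd i' q (i' q + delta)%N.
by have := sum_upd i p (i p - delta)%N; rewrite -/i'; lia.
Qed.

(** Greedy merging: each step takes the smallest remaining entry, the one at the receiver. Its key
    separates the two sides of the new cut. *)
Lemma stable_exists (K : nat) : (K <= \sum_(t < m.+1) size (L t))%N ->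
  exists g, [/\ fits g, (\sum_(t < m.+1) g t = K)%N & stable g].
Proof.
elim: K => [_|K IH ltK].
  exists [ffun=> 0%N]; split=> [t||t u]; first by rewrite ffunE.
    by rewrite big1 // => t; rewrite ffunE.
  rewrite lexi_pair !ffunE /bl eqxx bnd_simp /= /br.
  by case: (L u).
have [g [fg sum_g st]] := IH (ltnW ltK).
have [v gv] : exists v : 'I_m.+1, (g v < size (L v))%N.
  apply/existsP; apply: contraLR ltK => /existsPn ge_g.
  by rewrite -leqNgt -sum_g leq_sum // => t _; rewrite leqNgt.
set q := receiver L g.
(* If the receiver were exhausted, the minimum of [br] would be [+oo], yet [br] is below [+oo] at
   [v]. *)
have gq : (g q < size (L q))%N.
  rewrite ltn_neqAle fg andbT; apply/negP => /eqP eq_gq.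
  have : min_br L g <= br (L v) (g v) by apply: bigmin_le.
  rewrite -br_receiver -/q {1}/br eq_gq eqxx leNgt.
  by rewrite br_lt_pinfty.
exists (upd g q (g q).+1); split=> [t||t u].
- by rewrite ffunE; case: eqP => [->|].
- by have := sum_upd g q (g q).+1; lia.
have le_t : lkey (upd g q (g q).+1) t <= rkey g q.
  rewrite /lkey /rkey ffunE; case: eqP => [->|_]; first by rewrite bl_succ.
  exact: st.
apply: le_trans le_t (le_trans (rkey_receiver g u) _).
rewrite /rkey ffunE; case: eqP => [->|_] //.
by apply/key_le/br_mono; rewrite ?leqnSn.
Qed.

(** * The potential of one sequence *)

Definition gap (lo i hi g : nat) : nat :=
  ((hi - lo).*2 + ((i != g) && ((i == lo) || (i == hi))))%N.

(** If [i < hi], the width shrinks, and its doubled loss outweighs a second summand that grows by at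
    most 1. If [i = hi], that summand was 1 and drops to 0: [i - delta] is below [i], and it equals
    [lo] only when [i - lo = 1], in which case it equals [g]. *)
Lemma gap_donate (lo i hi g delta : nat) :
  (lo <= g < i)%N -> (i <= hi)%N -> (0 < delta <= uphalf (i - lo))%N ->
  (gap lo (i - delta) i g < gap lo i hi g)%N.
Proof.
rewrite /gap; do ?case: eqP => ? /=; lia.
Qed.

Lemma gap_receive (lo i hi g delta : nat) :
  (i < g <= hi)%N -> (lo <= i)%N -> (0 < delta <= uphalf (hi - i))%N ->
  (gap i (i + delta) hi g < gap lo i hi g)%N.
Proof.
rewrite /gap; do ?case: eqP => ? /=; lia.
Qed.

(** * Rounds of the algorithm *)

Definition encloses g s := forall t,
  [/\ (lb s t <= idx s t <= ub s t)%N, (lb s t <= g t <= ub s t)%N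
    & (ub s t <= size (L t))%N].

Definition potential g s : nat :=
  (\sum_(t < m.+1) gap (lb s t) (idx s t) (ub s t) (g t))%N.

Lemma round_progress g s : stable g -> encloses g s ->
  (\sum_(t < m.+1) idx s t = \sum_(t < m.+1) g t)%N ->
  (round L s = Return (idx s) /\ max_bl L (idx s) <= min_br L (idx s)) \/
  exists s', [/\ round L s = Continue s', encloses g s',
    (\sum_(t < m.+1) idx s' t = \sum_(t < m.+1) g t)%N
    & (potential g s' < potential g s)%N].
Proof.
case: s => lo hi i st enc sum_i; rewrite /round /= stop_lexi.
set p := donor L i; set q := receiver L i; simpl in sum_i.
case: ifPn => [pq|npq].
  left; split=> //; move: pq; rewrite lexi_pair => /andP[].
  by rewrite bl_donor br_receiver.
right.
have fi : fits i by move=> t; have [/=] := enc t; lia.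
have fg : fits g by move=> t; have [/=] := enc t; lia.
(* [g] passes the stopping test, so a failed test means that [i] differs from [g]. *)
have [v ne_v] : exists v : 'I_m.+1, i v != g v.
  apply/existsP; apply: contraNT npq => /existsPn eq_ig.
  have -> : i = g by apply/ffunP => v; apply/eqP; rewrite -[_ == _]negbK eq_ig.
  exact: st.
(* Equal sums and a difference at [v] give both an index where [i] exceeds [g] and one where it
   falls short. *)
have gp : (g p < i p)%N.
  apply: donor_excess => //; apply: (@sum_nat_eq_ltn _ _ _ v) => //.
  by rewrite eq_sym.
have iq : (i q < g q)%N.
  by apply: receiver_deficit => //; apply: (@sum_nat_eq_ltn _ _ _ v).
have pq : p != q by apply: contraTneq gp => ->; rewrite -leqNgt ltnW.
have [/= ip_bd gp_bd _] := enc p; have [/= iq_bd gq_bd _] := enc q.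
set delta := minn _ _.
(* [lo p <= g p < i p] and [i q < g q <= hi q], so both rounded halves are positive. *)
have [delta_gt0 delta_p delta_q] :
  [/\ (0 < delta)%N, (delta <= uphalf (i p - lo p))%N
    & (delta <= uphalf (hi q - i q))%N] by rewrite /delta; split; lia.
rewrite eqn0Ngt delta_gt0 /=; eexists; split; first by [].
- move=> t; rewrite /= !ffunE; have [/=] := enc t.
  case: (eqVneq t q) => [->|_]; last case: (eqVneq t p) => [->|_].
  + by rewrite (eq_sym q) (negPf pq); split; lia.
  + by split; lia.
  + by split; lia.
- by rewrite /= sum_move //; lia.
(* Only the summands at [p] and [q] change. *)
rewrite /potential /= (bigD1 p) //= [in ltnRHS](bigD1 p) //=.
rewrite (bigD1 q) 1?eq_sym //= [in ltnRHS](bigD1 q) 1?eq_sym //=.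
rewrite !ffunE !eqxx (negPf pq) (eq_sym q p) (negPf pq).
under eq_bigr => t /andP[/negPf tp /negPf tq] do rewrite !ffunE tp tq.
rewrite -addSn leq_add ?leq_add2r //.
  by apply: gap_donate; lia.
by apply/ltnW/gap_receive; lia.
Qed.

Lemma run_terminates g s : stable g -> encloses g s ->
  (\sum_(t < m.+1) idx s t = \sum_(t < m.+1) g t)%N ->
  exists i, (exists fuel, run L fuel s = Some i) /\
            valid_corank L (\sum_(t < m.+1) g t)%N i.
Proof.
move=> st; have [n] := ubnP (potential g s).
elim: n s => // n IH s le_n enc sum_s.
case: (round_progress st enc sum_s) => [[eq_s le_s]|[s' [eq_s enc' sum_s' lt_s]]].
  exists (idx s); split; first by exists 1%N; rewrite /= eq_s.
  by split=> // t; have [] := enc t; lia.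
have [|i [[fuel run_i] valid_i]] := IH s' _ enc' sum_s'; first by lia.
by exists i; split=> //; exists fuel.+1; rewrite /= eq_s.
Qed.

(** * The initial filling *)

Lemma fill_spec (ub : ivec m) (ts : seq 'I_m.+1) i (need : nat) :
  uniq ts -> (forall t, i t <= ub t)%N ->
  (need <= \sum_(t <- ts) (ub t - i t))%N ->
  (forall t, fill ub ts i need t <= ub t)%N /\
  (\sum_(t < m.+1) fill ub ts i need t = \sum_(t < m.+1) i t + need)%N.
Proof.
elim: ts i need => [|t ts IH] i need /=.
  by rewrite big_nil leqn0 => _ le_i /eqP->; rewrite addn0.
case/andP=> t_ts uniq_ts le_i; rewrite big_cons => le_need.
set k := minn _ _; set i' := upd _ _ _.
have le_i' u : (i' u <= ub u)%N.
  by rewrite ffunE; case: eqP => [->|_] //; have := le_i t; rewrite /k; lia.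
have /= sum_i' := sum_upd i t (i t + k)%N; rewrite -/i' in sum_i'.
have le_k : (k <= need)%N by rewrite /k; lia.
case: eqP => [need0|_]; first by split=> //; lia.
have [|le_f ->] := IH i' (need - k)%N uniq_ts le_i'; last by split=> //=; lia.
(* Since [t] is not in [ts], raising its entry leaves the room in the later sequences intact. *)
rewrite (eq_big_seq (fun u => (ub u - i u)%N)).
  by move: le_need => /=; rewrite /k; lia.
by move=> u uts; rewrite ffunE; case: eqP => // ut; rewrite -ut uts in t_ts.
Qed.

End CoRank.

Theorem theorem1 (d : Order.disp_t) (T : orderType d) (m : nat)
    (L : 'I_m.+1 -> seq T) (K : nat)
    (L_sorted : forall t : 'I_m.+1, sorted <=%O (L t))
    (K_le : K <= \sum_(t < m.+1) size (L t)) :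
  exists i : ivec m, corank_returns L K i /\ valid_corank L K i.
Proof.
have [g [fit_g sum_g stable_g]] := stable_exists L_sorted K_le.
have [|||le_f sum_f] := @fill_spec m [ffun t => size (L t)] (enum 'I_m.+1)
  [ffun=> 0] K.
- exact: enum_uniq.
- by move=> t; rewrite ffunE.
- rewrite big_enum /=; apply: leq_trans K_le _; apply: leq_sum => t _.
  by rewrite !ffunE subn0.
(* The initial bounds, 0 and [size (L t)], enclose every vector that fits, in particular [g]. *)
have [||i [run_i valid_i]] := @run_terminates _ _ _ L L_sorted g (init L K) stable_g.
- move=> t; have := le_f t; have := fit_g t.
  by rewrite /init /= !ffunE; split; lia.
- by rewrite sum_g sum_f big1 // => t _; exact: ffunE.
by exists i; split; rewrite // -sum_g.
Qed.
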